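(* Let $X$ be a geodesic metric space. Then affine functions on $X$ separate points of $X$ (i.e. for every pair of points $x\neq\bar x$ in $X$ there is an affine function $f:X\to\mathbb{R}$ with $f(x)\neq f(\bar x)$) if and only if $X$ is isometric to a convex subset of a normed vector space whose norm is strictly convex.
   Context: A geodesic in a metric space is an isometric embedding of an interval; $X$ is geodesic if any two points are joined by a geodesic. A function $f:X\to\mathbb{R}$ is called affine if for every arclength parametrized geodesic $\gamma$ in $X$ there are numbers $a,b$ (depending on $\gamma$) with $f(\gamma(t))=at+b$ for all $t$. A norm $\|\cdot\|$ on a vector space is strictly convex if $\|v+w\|<\|v\|+\|w\|$ for all linearly independent $v,w$. A subset of a vector space is convex if it contains the linear segment between any two of its points. *)

(* Defs.v *)
From HB Require Import structures.
From mathcomp Require Import all_boot all_order all_algebra.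
From mathcomp Require Import all_classical all_reals all_analysis.
Set Implicit Arguments. Unset Strict Implicit. Unset Printing Implicit Defensive.
Import Order.TTheory GRing.Theory Num.Theory.
Import numFieldNormedType.Exports.
Local Open Scope classical_set_scope.
Local Open Scope ring_scope.

Section Defs.
Variable R : realType.

Definition is_metric (T : Type) (d : T -> T -> R) : Prop :=
  (forall x y, d x y = 0 <-> x = y) /\
  (forall x y, d x y = d y x) /\
  (forall x y z, d x z <= d x y + d y z).

Definition is_interval (I : set R) : Prop :=
  forall x y z, I x -> I z -> x <= y -> y <= z -> I y.

Definition geodesic_on (T : Type) (d : T -> T -> R) (I : set R) (gamma : R -> T) : Prop :=
  is_interval I /\ forall s t, I s -> I t -> d (gamma s) (gamma t) = `|s - t|.

Definition geodesic_space (T : Type) (d : T -> T -> R) : Prop :=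
  forall x y : T, exists gamma : R -> T,
    geodesic_on d `[0, d x y] gamma /\ gamma 0 = x /\ gamma (d x y) = y.

Definition affine_fun (T : Type) (d : T -> T -> R) (f : T -> R) : Prop :=
  forall (I : set R) (gamma : R -> T), geodesic_on d I gamma ->
    exists a b : R, forall t, I t -> f (gamma t) = a * t + b.

Definition separates_points (T : Type) (d : T -> T -> R) : Prop :=
  forall x x' : T, x <> x' ->
    exists f : T -> R, affine_fun d f /\ f x <> f x'.

Definition lin_indep2 (V : normedModType R) (v w : V) : Prop :=
  forall a b : R, a *: v + b *: w = 0 -> a = 0 /\ b = 0.

Definition strictly_convex_norm (V : normedModType R) : Prop :=
  forall v w : V, lin_indep2 v w -> `|v + w| < `|v| + `|w|.

Definition convex_subset (V : normedModType R) (C : set V) : Prop :=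
  forall x y : V, C x -> C y -> forall t : R, 0 <= t -> t <= 1 ->
    C ((1 - t) *: x + t *: y).

Definition isometric_to (T : Type) (d : T -> T -> R) (V : normedModType R) (C : set V) : Prop :=
  exists phi : T -> V, phi @` setT = C /\
    forall x y : T, `|phi x - phi y| = d x y.

End Defs.

(* Main.v *)
(* Affine functions turn geodesics into segments, so if they separate points, then
   evaluation phi maps X injectively onto a convex subset of a space of functions,
   and the metric grows linearly along segments. It comes from a norm on the span of
   the differences as soon as d(x, y) = d(x', y') for every parallelogram with
   y - x = y' - x'. Set F(a, b) = d((1 - a) x + a x', (1 - b) y + b y'). Cutting at
   the common midpoint of the diagonals of a parallelogram gives
     2 F(a, b), 2 F(a + e, b + e) <= F(a + e, b) + F(a, b + e).
   Summing this along antidiagonal rows of n points with mesh e = 1/n^2, the second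
   differences telescope: one step along the diagonal changes the row sum by O(e),
   and all n^2 steps by O(1). The n summands of a row all lie within O(1/n) of the
   value on the diagonal, hence F(0, 0) - F(1, 1) = O(1/n).
   Equality in the triangle inequality produces a broken geodesic, which affine
   functions see as a segment; this is strict convexity. Conversely, geodesics of a
   strictly convex normed space are segments, so linear functionals are affine. *)
Require Import Defs.
From HB Require Import structures.
From mathcomp Require Import all_boot all_order all_algebra.
From mathcomp Require Import all_classical all_reals all_analysis.
From mathcomp Require Import zify ring lra.
Import Order.TTheory GRing.Theory Num.Theory.
Import numFieldNormedType.Exports.
Local Open Scope classical_set_scope.
Local Open Scope ring_scope.

(** * Second differences and the diagonal of the unit square *)

Lemma sum_second_difference (R : comNzRingType) (u : nat -> R) (n : nat) :
  \sum_(i < n) (u i.+2 - 2 * u i.+1 + u i) = (u n.+1 - u n) - (u 1%N - u 0%N).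
Proof.
elim: n => [|n IH]; first by rewrite big_ord0 subrr.
by rewrite big_ord_recr /= IH; ring.
Qed.

Section DiagonalConstancy.
Variables (R : realType) (F : R -> R -> R) (L : R).
Hypothesis F_lip : forall a b a' b' : R, 0 <= a <= 1 -> 0 <= b <= 1 ->
  0 <= a' <= 1 -> 0 <= b' <= 1 -> `|F a b - F a' b'| <= L * (`|a - a'| + `|b - b'|).
Hypothesis F_mid : forall a b e : R, 0 <= a -> 0 <= b -> 0 <= e ->
  a + e <= 1 -> b + e <= 1 ->
  2 * F a b <= F (a + e) b + F a (b + e) /\
  2 * F (a + e) (b + e) <= F (a + e) b + F a (b + e).

(* Moving an antidiagonal row of values of [F] along the diagonal averages it
   with itself, up to boundary terms. *)
Let row (e : R) (n : nat) (a b : R) := \sum_(i < n) F (a + i%:R * e) (b - i%:R * e).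

(** The midpoint inequality is used twice: on a mesh square with corner [(a, b)], then on the two
    squares joining its off-diagonal corners to the row. This leaves the average of three row
    neighbours with weights 1/4, 1/2, 1/4. *)
Lemma F_row_step (e a b : R) : 0 <= e -> 0 <= a - e -> a + e <= 1 ->
  0 <= b - e -> b + e <= 1 ->
  let D := F (a + e) (b - e) - 2 * F a b + F (a - e) (b + e) in
  F (a + e) (b + e) <= F a b + D / 4 /\ F (a - e) (b - e) <= F a b + D / 4.
Proof.
move=> e0 ae ae1 be be1 D.
have [| | | | |_] := @F_mid a b e; try lra.
have [| | | | |h1 h1'] := @F_mid a (b - e) e; try lra.
have [| | | | |h2 h2'] := @F_mid (a - e) b e; try lra.
have [| | | | |h3 _] := @F_mid (a - e) (b - e) e; try lra.
move: h1 h1' h2 h2' h3; rewrite !subrK /D; lra.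
Qed.

Lemma row_step (n : nat) (e a b : R) : (0 < n)%N -> 0 <= e -> 0 <= a - e ->
  a + n%:R * e <= 1 -> 0 <= b - n%:R * e -> b + e <= 1 ->
  row e n (a + e) (b + e) <= row e n a b + L * e /\
  row e n (a - e) (b - e) <= row e n a b + L * e.
Proof.
move=> n0 e0 ae ae1 be be1.
(* The row prolonged by one point at each end: [u i.+1] is its summand number [i], and the second
   differences of [u] are the [D] of [F_row_step]. *)
pose u (k : nat) := F (a - e + k%:R * e) (b + e - k%:R * e).
have ne : e <= n%:R * e by rewrite ler_peMl // ler1n.
have n1e : (n.+1)%:R * e = n%:R * e + e by rewrite -natr1; ring.
(* Each boundary difference moves both coordinates by [e]; two of them divided by 4 give the error
   [L * e]. *)
have bd : `|u n.+1 - u n| <= L * (2 * e) /\ `|u 1%N - u 0%N| <= L * (2 * e).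
  have nrm (x y : R) : x - y = e \/ x - y = - e -> `|x - y| = e.
    by case=> ->; rewrite ?normrN ger0_norm.
  rewrite /u mul1r mul0r n1e; split;
    (apply: le_trans (@F_lip _ _ _ _ _ _ _ _) _; first by lra).
  - lra.
  - lra.
  - lra.
  - by rewrite !nrm; [lra|right; ring|left; ring].
  - lra.
  - lra.
  - lra.
  - by rewrite !nrm; [lra|right; ring|left; ring].
have S := sum_second_difference R u n.
have UE : row e n a b + (\sum_(i < n) (u i.+2 - 2 * u i.+1 + u i)) / 4 =
  \sum_(i < n) (u i.+1 + (u i.+2 - 2 * u i.+1 + u i) / 4).
  rewrite mulr_suml /row -big_split /=.
  by apply: eq_bigr => i _; congr (_ + _); rewrite /u -natr1; congr F; ring.
have le_row : row e n a b + (\sum_(i < n) (u i.+2 - 2 * u i.+1 + u i)) / 4 <=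
    row e n a b + L * e.
  rewrite lerD2l S; move: bd => [/ler_normlP[? ?] /ler_normlP[? ?]]; lra.
have stp (i : 'I_n) := @F_row_step e (a + i%:R * e) (b - i%:R * e) e0.
have side (i : 'I_n) : 0 <= i%:R * e /\ i%:R * e + e <= n%:R * e.
  split; first by rewrite mulr_ge0.
  have -> : i%:R * e + e = (i.+1)%:R * e by rewrite -natr1; ring.
  by rewrite ler_wpM2r // ler_nat.
have le_congr (x x' y y' : R) : x = x' -> y = y' -> x <= y -> x' <= y'.
  by move=> -> ->.
split; apply: le_trans le_row; rewrite UE; apply: ler_sum => i _.
- have [i0 i1] := side i.
  have [| | | |h _] := stp i; [lra..|].
  move: h; rewrite /u -(@natr1 R i.+1) -(@natr1 R i); apply: le_congr.
    by congr F; ring.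
  by congr (F _ _ + (F _ _ - 2 * F _ _ + F _ _) / 4); ring.
- have [i0 i1] := side i.
  have [| | | |_ h] := stp i; [lra..|].
  move: h; rewrite /u -(@natr1 R i.+1) -(@natr1 R i); apply: le_congr.
    by congr F; ring.
  by congr (F _ _ + (F _ _ - 2 * F _ _ + F _ _) / 4); ring.
Qed.

Lemma row_steps (n N : nat) (e a : R) : (0 < n)%N -> 0 <= e -> 0 <= a - n%:R * e ->
  a + N%:R * e + n%:R * e <= 1 ->
  `|row e n (a + N%:R * e) (a + N%:R * e) - row e n a a| <= N%:R * (L * e).
Proof.
move=> n0 e0 ae.
have ne : e <= n%:R * e by rewrite ler_peMl // ler1n.
elim: N => [|N IH]; first by rewrite !mul0r addr0 subrr normr0.
have -> : N.+1%:R * e = N%:R * e + e by rewrite -natr1; ring.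
have -> : N.+1%:R * (L * e) = N%:R * (L * e) + L * e by rewrite -natr1; ring.
have Ne : 0 <= N%:R * e by rewrite mulr_ge0.
have : a <= a + N%:R * e by lra.
rewrite (addrA a); move: (a + N%:R * e) IH => c IH ac c1.
have {}IH := IH ltac:(lra).
have [| | | |h1 _] := @row_step n e c c n0 e0; [lra..|].
(* Stepping back from the next row gives the opposite inequality. *)
have [| | | |_ h2] := @row_step n e (c + e) (c + e) n0 e0; [lra..|].
move: h2; rewrite addrK => h2.
by move: IH => /ler_normlP[? ?]; apply/ler_normlP; split; lra.
Qed.

(** Both coordinates of every row point lie within [|a - t| + n%:R * e] of [t]. *)
Lemma row_diag (n : nat) (e a t : R) : 0 <= e -> 0 <= a - n%:R * e ->
  a + n%:R * e <= 1 -> 0 <= t <= 1 ->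
  `|row e n a a - n%:R * F t t| <= n%:R * (L * (2 * (`|a - t| + n%:R * e))).
Proof.
move=> e0 ae ae1 t01.
have -> : row e n a a - n%:R * F t t =
    \sum_(i < n) (F (a + i%:R * e) (a - i%:R * e) - F t t).
  by rewrite sumrB sumr_const card_ord mulr_natl.
have -> : n%:R * (L * (2 * (`|a - t| + n%:R * e))) =
    \sum_(i < n) (L * (2 * (`|a - t| + n%:R * e))).
  by rewrite sumr_const card_ord mulr_natl.
apply: le_trans (ler_norm_sum _ _ _) _; apply: ler_sum => i _.
have i0 : 0 <= i%:R * e by rewrite mulr_ge0.
have i1 : i%:R * e <= n%:R * e by rewrite ler_wpM2r // ler_nat ltnW.
have L0 : 0 <= L.
  have := @F_lip 0 0 1 0 ltac:(lra) ltac:(lra) ltac:(lra) ltac:(lra).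
  rewrite subrr sub0r normrN normr1 normr0 addr0 mulr1; exact: le_trans.
apply: le_trans (@F_lip _ _ _ _ _ _ _ _) _; [lra..|].
apply: ler_wpM2l => //.
have h1 : `|a + i%:R * e - t| <= `|a - t| + n%:R * e.
  rewrite addrAC; apply: le_trans (ler_normD _ _) _; rewrite (ger0_norm i0); lra.
have h2 : `|a - i%:R * e - t| <= `|a - t| + n%:R * e.
  rewrite addrAC; apply: le_trans (ler_normB _ _) _; rewrite (ger0_norm i0); lra.
lra.
Qed.

Lemma diagonal_constancy : F 0 0 = F 1 1.
Proof.
apply/eqP; rewrite -subr_eq0 -normr_eq0; apply/eqP/le_anti; rewrite normr_ge0 andbT.
(* Comparing a row with the diagonal costs [4 * L] near each corner, and moving the row from one to
   the other costs at most [L]. *)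
suff key n : (2 <= n)%N -> n%:R * `|F 0 0 - F 1 1| <= 9 * L.
  rewrite leNgt; apply/negP => D0.
  have := archi_boundP (ltac:(exact: normr_ge0) : 0 <= `|9 * L / `|F 0 0 - F 1 1| |).
  set N := Num.bound _ => hN.
  have := key N.+2 isT; rewrite -ler_pdivlMr // => h.
  have h' := le_lt_trans (ler_norm _) hN.
  have := le_lt_trans h h'; rewrite ltr_nat; lia.
move=> n2.
have n0 : (n%:R : R) != 0 by rewrite pnatr_eq0; lia.
have n0' : 0 < (n%:R : R) by rewrite ltr0n; lia.
pose e : R := n%:R^-1 ^+ 2.
have e0 : 0 <= e by rewrite exprn_ge0 // invr_ge0 ltW.
have ne : n%:R * e = n%:R^-1 by rewrite /e; field.
have i2 : n%:R^-1 * 2 <= (1 : R).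
  by rewrite mulrC ler_pdivrMr // mul1r ler_nat.
have i0 : 0 < n%:R^-1 :> R by rewrite invr_gt0.
(* The coordinates of a row spread up to [1/n] around its base, so the base travels only from [1/n]
   to [1 - 1/n], in [n * (n - 2)] steps of length [e]. *)
have Ne : (n * (n - 2))%:R * e = 1 - 2 / n%:R.
  by rewrite natrM natrB // /e; field.
pose a : R := n%:R^-1.
have h1 := @row_steps n (n * (n - 2)) e a ltac:(lia) e0.
rewrite Ne ne /a in h1.
have {}h1 := h1 ltac:(lra) ltac:(lra).
have h2 := @row_diag n e a 0 e0; rewrite ne /a in h2.
have {}h2 := h2 ltac:(lra) ltac:(lra) ltac:(lra).
have h3 := @row_diag n e (1 - a) 1 e0; rewrite ne /a in h3.
have {}h3 := h3 ltac:(lra) ltac:(lra) ltac:(lra).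
have E : n%:R^-1 + (1 - 2 / n%:R) = 1 - n%:R^-1 :> R by field.
rewrite E in h1.
have ni : `|n%:R^-1| = n%:R^-1 :> R by rewrite ger0_norm // ltW.
rewrite subr0 ni in h2.
rewrite addrAC subrr sub0r normrN ni in h3.
have L0 : 0 <= L.
  have := @F_lip 0 0 1 0 ltac:(lra) ltac:(lra) ltac:(lra) ltac:(lra).
  rewrite subrr sub0r normrN normr1 normr0 addr0 mulr1; exact: le_trans.
have E2 : n%:R * (L * (2 * (n%:R^-1 + n%:R^-1))) = 4 * L by field.
have E3 : (n * (n - 2))%:R * (L * e) <= L.
  by rewrite mulrCA Ne ler_piMr //; lra.
rewrite E2 in h2 h3.
rewrite -(ger0_norm (ltW n0')) -normrM mulrBr.
move: h1 h2 h3 => /ler_normlP[? ?] /ler_normlP[? ?] /ler_normlP[? ?].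
by apply/ler_normlP; split; lra.
Qed.
End DiagonalConstancy.

(** * Normed modules from a norm on a subspace *)

Record subspace_norm {R : realType} (E : lmodType R) := SubspaceNorm {
  snorm_pred : {pred E};
  snorm_fun : E -> R;
  snorm_closed : submod_closed snorm_pred;
  snormD : forall v w, v \in snorm_pred -> w \in snorm_pred ->
    snorm_fun (v + w) <= snorm_fun v + snorm_fun w;
  snormZ : forall a v, v \in snorm_pred -> snorm_fun (a *: v) = `|a| * snorm_fun v;
  snorm_eq0 : forall v, v \in snorm_pred -> snorm_fun v = 0 -> v = 0 }.

Arguments snorm_pred {R E}.
Arguments snorm_fun {R E}.

Section SubspaceNormedModule.
Variables (R : realType) (E : lmodType R) (n : subspace_norm E).

Definition snorm_mem : {pred E} := snorm_pred n.

HB.instance Definition _ :=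
  GRing.isSubmodClosed.Build R E snorm_mem (snorm_closed E n).

Record snorm_space := SnormSpace { snorm_val : E; _ : snorm_val \in snorm_mem }.

HB.instance Definition _ := [isSub for snorm_val].
HB.instance Definition _ := [Choice of snorm_space by <:].
HB.instance Definition _ := [SubChoice_isSubLmodule of snorm_space by <:].

Definition snorm_norm (v : snorm_space) : R := snorm_fun n (val v).

Lemma snorm_normD v w : snorm_norm (v + w) <= snorm_norm v + snorm_norm w.
Proof. by rewrite /snorm_norm raddfD /=; apply: snormD; exact: valP. Qed.

Lemma snorm_normZ a v : snorm_norm (a *: v) = `|a| * snorm_norm v.
Proof. by rewrite /snorm_norm linearZ /=; apply: snormZ; exact: valP. Qed.

Lemma snorm_norm_eq0 v : snorm_norm v = 0 -> v = 0.
Proof. by move=> /(snorm_eq0 E n _ (valP v)) v0; apply: val_inj. Qed.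

HB.instance Definition _ := Lmodule_isNormed.Build R snorm_space
  snorm_normD snorm_normZ snorm_norm_eq0.

End SubspaceNormedModule.

(** The linear map [i] lets vectors of [V] be handled as elements of [E], while the subtype stays
    hidden. *)
Lemma normed_subspace (R : realType) (E : lmodType R) (n : subspace_norm E) :
  exists (V : normedModType R) (i : {linear V -> E}),
    [/\ injective i, forall v, i v \in snorm_pred n,
        forall e, e \in snorm_pred n -> exists v, i v = e &
        forall v, `|v| = snorm_fun n (i v)].
Proof.
exists (snorm_space R E n : normedModType R), (val : {linear snorm_space R E n -> E}).
split; [exact: val_inj|exact: valP| |by []].
by move=> e en; exists (SnormSpace R E n e en).
Qed.

(** * The norm on differences of points *)

Section AffineCoordinates.
Variables (R : realType) (T : Type) (d : T -> T -> R) (I : Type).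
Variables (phi : T -> I -> R) (conv : R -> T -> T -> T).
Hypothesis d_metric : is_metric d.
Hypothesis phi_inj : forall x y, phi x =1 phi y -> x = y.
Hypothesis phi_conv : forall (t : R) x y i, 0 <= t <= 1 ->
  phi (conv t x y) i = (1 - t) * phi x i + t * phi y i.
Hypothesis d_conv : forall (s t : R) x y, 0 <= s <= 1 -> 0 <= t <= 1 ->
  d (conv s x y) (conv t x y) = `|s - t| * d x y.

Lemma dist_xx x : d x x = 0.
Proof. by apply/(proj1 d_metric). Qed.

Lemma dist_sym x y : d x y = d y x.
Proof. exact: (proj1 (proj2 d_metric)). Qed.

Lemma dist_triangle x y z : d x z <= d x y + d y z.
Proof. exact: (proj2 (proj2 d_metric)). Qed.

Lemma dist_ge0 x y : 0 <= d x y.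
Proof. have := dist_triangle x y x; rewrite dist_xx (dist_sym y x); lra. Qed.

Lemma conv0 x y : conv 0 x y = x.
Proof. by apply: phi_inj => i; rewrite phi_conv; [ring | lra]. Qed.

Lemma conv1 x y : conv 1 x y = y.
Proof. by apply: phi_inj => i; rewrite phi_conv; [ring | lra]. Qed.

Lemma d_conv0 t x y : 0 <= t <= 1 -> d (conv t x y) x = t * d x y.
Proof.
move=> t01; have := d_conv t 0 x y t01; rewrite conv0 => ->; last by lra.
by rewrite subr0 ger0_norm //; lra.
Qed.

Lemma d_mid x y : d x (conv 2^-1 x y) = d x y / 2 /\ d (conv 2^-1 x y) y = d x y / 2.
Proof.
have h := d_conv 0 2^-1 x y; have h' := d_conv 2^-1 1 x y.
rewrite conv0 in h; rewrite conv1 in h'; rewrite h ?h'; [|lra..].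
rewrite (distrC _ 1) sub0r normrN !ger0_norm; [|lra..].
by split; field.
Qed.

Lemma d_diff_le x y x' y' : `|d x y - d x' y'| <= d x x' + d y y'.
Proof.
have := dist_triangle x x' y; have := dist_triangle x' y' y.
have := dist_triangle x' x y'; have := dist_triangle x y y'.
by rewrite (dist_sym x' x) (dist_sym y' y) => ? ? ? ?; apply/ler_normlP; split; lra.
Qed.

Lemma parallelogram x y x' y' :
  (forall i, phi y i - phi x i = phi y' i - phi x' i) -> d x y = d x' y'.
Proof.
move=> par; pose F (a b : R) := d (conv a x x') (conv b y y').
have := @diagonal_constancy R F (d x x' + d y y').
rewrite /F !conv0 !conv1; apply.
- move=> a b a' b' a01 b01 a01' b01'.
  apply: le_trans (d_diff_le _ _ _ _) _; rewrite !d_conv // mulrDl !mulrDr.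
  have := mulr_ge0 (dist_ge0 x x') (normr_ge0 (b - b')).
  have := mulr_ge0 (dist_ge0 y y') (normr_ge0 (a - a')).
  by rewrite !(mulrC `|_|); lra.
- move=> a b e a0 b0 e0 ae be.
  (* The midpoints agree in coordinates because [x' - x = y' - y]. Through this point, each of the
     sides [F a b] and [F (a + e) (b + e)] is at most half the sum of the diagonals. *)
  have cross : conv 2^-1 (conv a x x') (conv (b + e) y y') =
      conv 2^-1 (conv (a + e) x x') (conv b y y').
    by apply: phi_inj => i; have := par i; rewrite !phi_conv; [nra|lra..].
  have [h1 h2] := d_mid (conv a x x') (conv (b + e) y y').
  have [h3 h4] := d_mid (conv (a + e) x x') (conv b y y').
  rewrite -cross in h3 h4.
  have h5 := dist_triangle (conv a x x') (conv 2^-1 (conv a x x') (conv (b + e) y y'))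
                (conv b y y').
  have h6 := dist_triangle (conv (a + e) x x') (conv 2^-1 (conv a x x') (conv (b + e) y y'))
                (conv (b + e) y y').
  by split; lra.
Qed.

(* [v] is a multiple of a difference of points of [T], and [r] is the norm that
   an isometric embedding forces on it. *)
Definition dispn (v : I -> R) (r : R) : Prop := exists (s : R) (p q : T),
  [/\ 0 <= s, forall i, v i = s * (phi p i - phi q i) & r = s * d p q].

(** Moving [p] towards [q] in the ratio [s / t] makes up for the larger factor; this brings two
    representations to the same factor. *)
Lemma dispn_scale (s t : R) p q : 0 <= s <= t -> 0 < t -> exists p',
  (forall i, s * (phi p i - phi q i) = t * (phi p' i - phi q i)) /\
  s * d p q = t * d p' q.
Proof.
move=> st t0.
have st01 : 0 <= s / t <= 1.
  by rewrite divr_ge0 ?ler_pdivrMr ?mul1r //; lra.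
exists (conv (s / t) q p); split=> [i|].
  rewrite phi_conv //; by field; exact: lt0r_neq0.
rewrite d_conv0 // (dist_sym q p); by field; exact: lt0r_neq0.
Qed.

(** At the common factor [t] the two pairs become opposite sides of a parallelogram. *)
Lemma dispn_le_inj v r v' r' (s t : R) p q p' q' : 0 <= s <= t ->
  (forall i, v i = s * (phi p i - phi q i)) -> r = s * d p q ->
  (forall i, v' i = t * (phi p' i - phi q' i)) -> r' = t * d p' q' ->
  v =1 v' -> r = r'.
Proof.
move=> st vE -> v'E -> vv'.
have [t0|t0] := leP t 0.
  have -> : s = 0 by lra.
  have -> : t = 0 by lra.
  by rewrite !mul0r.
have [p1 [h ->]] := dispn_scale s t p q st t0.
congr (_ * _); rewrite dist_sym (dist_sym p'); apply: parallelogram => i.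
apply: (mulfI (lt0r_neq0 t0)).
by rewrite -h -vE -v'E vv'.
Qed.

Lemma dispn_inj v r r' : dispn v r -> dispn v r' -> r = r'.
Proof.
move=> [s [p [q [s0 vE rE]]]] [t [p' [q' [t0 vE' rE']]]].
have [st|/ltW st] := leP s t.
  by apply: (@dispn_le_inj v r v r' s t p q p' q') => //; rewrite s0.
by apply/esym/(@dispn_le_inj v r' v r t s p' q' p q) => //; rewrite t0.
Qed.

Lemma dispn_common v w r r' : dispn v r -> dispn w r' -> exists s p q p' q',
  [/\ 0 < s, forall i, v i = s * (phi p i - phi q i), r = s * d p q,
      forall i, w i = s * (phi p' i - phi q' i) & r' = s * d p' q'].
Proof.
move=> [s [p [q [s0 vE ->]]]] [t [p' [q' [t0 wE ->]]]].
(* The summand 1 keeps the common factor positive when [s] and [t] both vanish. *)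
have [||p1 [h1 h1']] := dispn_scale s (s + t + 1) p q; [lra..|].
have [||p2 [h2 h2']] := dispn_scale t (s + t + 1) p' q'; [lra..|].
exists (s + t + 1), p1, q, p2, q'; split => //; first lra.
- by move=> i; rewrite vE h1.
- by move=> i; rewrite wE h2.
Qed.

(* Midpoints of points representing [v] and [w] with a common factor put the two end to end. *)
Lemma dispn_triangle v w r r' : dispn v r -> dispn w r' -> exists s a b c,
  [/\ 0 < s, r = s * d a b & r' = s * d b c] /\
  [/\ forall i, v i = s * (phi b i - phi a i),
      forall i, w i = s * (phi c i - phi b i) &
      dispn (fun i => v i + w i) (s * d a c)].
Proof.
move=> Dv Dw; have [s [p [q [p' [q' [s0 vE rE wE rE']]]]]] := dispn_common _ _ _ _ Dv Dw.
pose a := conv 2^-1 q q'; pose b := conv 2^-1 p q'; pose c := conv 2^-1 p p'.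
have vE2 i : v i = s * 2 * (phi b i - phi a i).
  by rewrite vE /a /b !phi_conv; [field|lra..].
have wE2 i : w i = s * 2 * (phi c i - phi b i).
  by rewrite wE /c /b !phi_conv; [field|lra..].
exists (s * 2), a, b, c; split; split => //; first lra.
- by rewrite dist_sym; apply: (dispn_inj _ _ _ Dv); exists (s * 2), b, a; split => //; lra.
- by rewrite dist_sym; apply: (dispn_inj _ _ _ Dw); exists (s * 2), c, b; split => //; lra.
- exists (s * 2), c, a; split; [lra| |by rewrite dist_sym].
  by move=> i; rewrite vE2 wE2; ring.
Qed.

Lemma dispnD v w r r' : dispn v r -> dispn w r' ->
  exists2 r'', dispn (fun i => v i + w i) r'' & r'' <= r + r'.
Proof.
move=> Dv Dw; have [s [a [b [c [[s0 -> ->] [_ _ Dvw]]]]]] := dispn_triangle _ _ _ _ Dv Dw.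
by exists (s * d a c) => //; rewrite -mulrDr ler_pM2l // dist_triangle.
Qed.

Lemma dispnZ k v r : dispn v r -> dispn (fun i => k * v i) (`|k| * r).
Proof.
move=> [s [p [q [s0 vE ->]]]].
have [k0|k0] := leP 0 k.
  exists (k * s), p, q; split; [exact: mulr_ge0|by move=> i; rewrite vE mulrA|].
  by rewrite ger0_norm // mulrA.
exists (- k * s), q, p; split; first by apply: mulr_ge0 => //; lra.
  by move=> i; rewrite vE; ring.
by rewrite ltr0_norm // mulrA dist_sym.
Qed.

Lemma dispn_eq0 v : dispn v 0 -> forall i, v i = 0.
Proof.
move=> [s [p [q [s0 vE /esym/eqP]]]]; rewrite mulf_eq0 => /orP[/eqP s00|/eqP pq] i.
  by rewrite vE s00 mul0r.
by rewrite vE ((proj1 d_metric p q).1 pq) subrr mulr0.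
Qed.

Lemma dispn_sub x y : dispn (fun i => phi x i - phi y i) (d x y).
Proof. by exists 1, x, y; split; rewrite ?ler01 ?mul1r // => i; rewrite mul1r. Qed.

Variable x0 : T.

Definition disp_pred : {pred (I -> R)} := fun v => `[< exists r, dispn v r >].
(** The value is unique by [dispn_inj]; the default 0 is taken outside [disp_pred]. *)
Definition disp_norm (v : I -> R) : R := xget 0 [set r | dispn v r].

Lemma disp_normP v : v \in disp_pred -> dispn v (disp_norm v).
Proof. by move=> /asboolP[r vr]; exact: (xgetI 0 vr). Qed.

Lemma disp_normE v r : dispn v r -> disp_norm v = r.
Proof. by move=> vr; exact: (dispn_inj _ _ _ (xgetI 0 vr) vr). Qed.

(** The multiples of differences already form a subspace, so no span has to be taken; [x0] supplies
    the zero vector. *)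
Lemma disp_pred_closed : submod_closed disp_pred.
Proof.
split; first by apply/asboolP; exists (0 * d x0 x0), 0, x0, x0; split => // i; rewrite mul0r.
move=> a v w /disp_normP Dv /disp_normP Dw; apply/asboolP.
have [r Dr _] := dispnD _ _ _ _ (dispnZ a v _ Dv) Dw.
by exists r.
Qed.

Lemma disp_normD v w : v \in disp_pred -> w \in disp_pred ->
  disp_norm (v + w) <= disp_norm v + disp_norm w.
Proof.
move=> /disp_normP Dv /disp_normP Dw.
have [r Dr] := dispnD _ _ _ _ Dv Dw.
by rewrite (disp_normE (v + w) r Dr).
Qed.

Lemma disp_normZ a v : v \in disp_pred -> disp_norm (a *: v) = `|a| * disp_norm v.
Proof.
by move=> /disp_normP Dv; apply: disp_normE; exact: (dispnZ a v _ Dv).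
Qed.

Lemma disp_norm_eq0 v : v \in disp_pred -> disp_norm v = 0 -> v = 0.
Proof.
move=> /disp_normP + v0; rewrite v0 => Dv; apply/funext.
exact: (dispn_eq0 v Dv).
Qed.

Definition disp_subspace_norm : subspace_norm (I -> R) :=
  SubspaceNorm R (I -> R) disp_pred disp_norm disp_pred_closed
    disp_normD disp_normZ disp_norm_eq0.

(** Points are sent to their displacement from [x0]. The hypothesis, with [k] as common direction,
    records what coordinates see of a broken geodesic and yields strict convexity. *)
Lemma embedding_of_affine_coordinates :
  (forall a b c, d a c = d a b + d b c -> exists k : I -> R, forall i,
    phi b i - phi a i = k i * d a b /\ phi c i - phi b i = k i * d b c) ->
  exists (V : normedModType R) (C : set V),
    @strictly_convex_norm R V /\ @convex_subset R V C /\ @isometric_to R T d V C.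
Proof.
move=> collinear.
have [V [g [g_inj gP g_surj gn]]] := normed_subspace R (I -> R) disp_subspace_norm.
have mem_sub x : (fun i => phi x i - phi x0 i) \in snorm_pred disp_subspace_norm.
  by apply/asboolP; exists (d x x0); exact: dispn_sub.
have [psi psiP] := choice (fun x => g_surj _ (mem_sub x)).
have gD (v w : V) i : g (v + w) i = g v i + g w i by rewrite raddfD.
have gB (v w : V) i : g (v - w) i = g v i - g w i by rewrite raddfB.
have gZ a (v : V) i : g (a *: v) i = a * g v i by rewrite linearZ.
have g0 i : g 0 i = 0 by rewrite raddf0.
have psiE x i : g (psi x) i = phi x i - phi x0 i by rewrite psiP.
exists V, (range psi); split; [|split].
- move=> v w vw; rewrite !gn /=.
  have Dv := disp_normP _ (gP v); have Dw := disp_normP _ (gP w).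
  have [s [a [b [c [[s0 vE wE] [gvE gwE Dvw]]]]]] := dispn_triangle _ _ _ _ Dv Dw.
  have -> : disp_norm (g (v + w)) = s * d a c.
    by apply: disp_normE; congr (dispn _ _) : Dvw; apply/funext => i; rewrite gD.
  rewrite vE wE -mulrDr ltr_pM2l // lt_neqAle dist_triangle // andbT.
  apply/eqP => /collinear[k kE].
  (* Both vectors are multiples of [k], so this combination vanishes; independence then gives
     [d a b = 0], hence [v = 0], which contradicts independence. *)
  have [|_ dab] := vw (d b c) (- d a b).
    apply: g_inj; apply/funext => i; rewrite gD !gZ g0 gvE gwE !(kE i).1 !(kE i).2.
    by ring.
  have [|/eqP] := vw 1 0; last by rewrite oner_eq0.
  apply: g_inj; apply/funext => i; rewrite gD !gZ g0 gvE !(kE i).1.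
  have -> : d a b = 0 by lra.
  by ring.
- move=> _ _ [x _ <-] [y _ <-] t t0 t1; exists (conv t x y) => //.
  apply: g_inj; apply/funext => i; rewrite gD !gZ !psiE phi_conv ?t0 //; ring.
- exists psi; split => // x y; rewrite gn /=; apply: disp_normE.
  have -> : (g (psi x - psi y) : I -> R) = fun i => phi x i - phi y i.
    by apply/funext => i; rewrite gB !psiE; ring.
  exact: dispn_sub.
Qed.

End AffineCoordinates.

(** * Separation by linear functionals *)

(* A subspace maximal among those avoiding [u] is a complement of the line through [u]. *)
Lemma linear_functional_separates (R : fieldType) (V : lmodType R) (u : V) : u <> 0 ->
  exists f : V -> R, (forall a v w, f (a *: v + w) = a * f v + f w) /\ f u <> 0.
Proof.
move=> u0.
(* [P] admits the empty set, which is the union of the empty chain; that [M] contains 0 comes from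
   maximality, by comparison with [[set 0]]. *)
pose P (A : set V) := (forall a v w, A v -> A w -> A (a *: v + w)) /\ ~ A u.
have [F FP Ftot|M [[Mlin Mu] Mmax]] := @Zorn_bigcup V P.
  split; last by move=> [A FA]; apply: (FP A FA).2.
  move=> a v w [A FA Av] [B FB Bw].
  have [AB|BA] := Ftot A B FA FB.
  - by exists B => //; apply: (FP B FB).1 => //; exact: AB.
  - by exists A => //; apply: (FP A FA).1 => //; exact: BA.
have M0 : M 0.
  apply: contrapT => nM0; apply: (Mmax [set 0]); split.
  - move=> v Mv; have := Mlin (-1) v v Mv Mv.
    by rewrite scaleN1r addNr.
  - by move=> h; apply: nM0; exact: (h 0).
  - by move=> a v w /= -> ->; rewrite scaler0 addr0.
  - by move=> /= u00; exact: u0.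
have MZ a v : M v -> M (a *: v) by move=> Mv; rewrite -(addr0 (_ *: v)); exact: Mlin.
have cov v : exists c : R, M (v - c *: u).
  have [Mv|nMv] := pselect (M v); first by exists 0; rewrite scale0r subr0.
  (* The span of [M] and [v] exceeds [M], so by maximality it contains [u]; solving for [v] gives
     the coefficient. *)
  pose B : set V := [set w | exists a m, M m /\ w = m + a *: v].
  have BM : M `<` B.
    split; first by move=> m Mm; exists 0, m; rewrite scale0r addr0.
    by move=> /(_ v) h; apply: nMv; apply: h; exists 1, 0; rewrite scale1r add0r.
  have : ~ P B by exact: Mmax.
  have [[a [m [Mm uE]]] _|nBu []] := pselect (B u); last first.
    split => // a _ _ [b [m [Mm ->]]] [c [m' [Mm' ->]]].
    exists (a * b + c), (a *: m + m'); split; first exact: Mlin.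
    by rewrite scalerDr scalerDl scalerA addrACA.
  have a0 : a != 0.
    by apply/eqP => a0; apply: Mu; rewrite uE a0 scale0r addr0.
  exists a^-1; rewrite uE scalerDr scalerA mulVf // scale1r opprD addrCA subrr addr0.
  by rewrite -scaleN1r; exact/MZ/MZ.
have [f fP] := choice cov.
(* Two different coefficients would put a nonzero multiple of [u] into [M]. *)
have funiq v c : M (v - c *: u) -> f v = c.
  move=> Mc; apply: contrapT => /eqP; rewrite -subr_eq0 => fc; apply: Mu.
  have := MZ (f v - c)^-1 _ (Mlin (-1) _ _ (fP v) Mc).
  by rewrite scaleN1r opprB addrA subrK -scalerBl scalerA mulVf // scale1r.
exists f; split=> [a v w|].
  apply: funiq; have := Mlin a _ _ (fP v) (fP w).
  by rewrite scalerBr scalerA addrACA -opprD -scalerDl.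
by rewrite (funiq u 1) ?scale1r ?subrr //; apply/eqP/oner_neq0.
Qed.

(** * Geodesics in strictly convex normed spaces *)

Section StrictlyConvex.
Variables (R : realType) (V : normedModType R).
Hypothesis V_strict : @strictly_convex_norm R V.

(** Equality forces dependence, so [w = k *: v] as [v] is nonzero; then [|1 + k| = 1 + |k|] excludes
    a negative [k]. *)
Lemma strictly_convex_collinear (v w : V) : 0 < `|v| -> `|v + w| = `|v| + `|w| ->
  `|v| *: w = `|w| *: v.
Proof.
move=> v0 vwE.
have : ~ lin_indep2 v w by move=> /V_strict; rewrite vwE ltxx.
move=> /existsNP[a /existsNP[b /not_implyP[ab nab]]].
have b0 : b != 0.
  apply/eqP => b0; apply: nab; split => //.
  move: ab; rewrite b0 scale0r addr0 => /eqP; rewrite scaler_eq0 -[v == 0]normr_eq0.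
  by rewrite (gt_eqF v0) orbF => /eqP.
have [k wE] : exists k : R, w = k *: v.
  exists (- a / b); rewrite mulrC -scalerA scaleNr.
  by have /eqP := ab; rewrite addr_eq0 => /eqP ->; rewrite opprK scalerA mulVf ?scale1r.
move: vwE; rewrite wE normrZ.
rewrite -{1}(scale1r v) -scalerDl normrZ -{2}(mul1r `|v|) -mulrDl => /(mulIf (lt0r_neq0 v0)).
move=> kE; have k0 : 0 <= k.
  rewrite leNgt; apply/negP => k0; move: kE; rewrite (ltr0_norm k0).
  by have [h|h] := leP 0 (1 + k); [rewrite (ger0_norm h)|rewrite (ltr0_norm h)] => kE; lra.
by rewrite ger0_norm // !scalerA mulrC.
Qed.

(** The lengths of two consecutive chords add up to the length of their sum, so the chords have the
    same direction. *)
Lemma geodesic_in_strictly_convex (I : set R) (c : R -> V) :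
  (forall s t, I s -> I t -> `|c s - c t| = `|s - t|) ->
  forall r s t, I r -> I s -> I t -> r < s -> s < t ->
  (s - r) *: (c t - c s) = (t - s) *: (c s - c r).
Proof.
move=> cI r s t Ir Is It rs st.
have e1 : `|c s - c r| = s - r by rewrite cI // gtr0_norm // subr_gt0.
have e2 : `|c t - c s| = t - s by rewrite cI // gtr0_norm // subr_gt0.
have e3 : `|c t - c r| = t - r by rewrite cI // gtr0_norm // subr_gt0; lra.
have := strictly_convex_collinear (c s - c r) (c t - c s).
rewrite e1 e2; apply; first by rewrite subr_gt0.
by rewrite addrC addrA subrK e3; lra.
Qed.
End StrictlyConvex.

(** Two points [r < s] of [I] fix the line, and each position of [t] relative to them is an instance
    of the chord condition. With at most one point in [I], a constant does. *)
Lemma affine_of_chords (R : realFieldType) (I : set R) (h : R -> R) :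
  (forall r s t, I r -> I s -> I t -> r < s -> s < t ->
    (s - r) * (h t - h s) = (t - s) * (h s - h r)) ->
  exists a b, forall t, I t -> h t = a * t + b.
Proof.
move=> H.
have [[r [s [Ir [Is rs]]]]|no] := pselect (exists r s, I r /\ I s /\ r < s).
  have rs0 : s - r != 0 by rewrite subr_eq0 gt_eqF.
  exists ((h s - h r) / (s - r)), (h r - (h s - h r) / (s - r) * r) => t It.
  suff E : (s - r) * (h t - h r) = (t - r) * (h s - h r).
    by apply: (mulfI rs0); rewrite -(subrK (h r) (h t)) mulrDr E; field.
  have [tr|rt|->] := ltgtP t r; last by rewrite !subrr mulr0 mul0r.
    by have := H _ _ _ It Ir Is tr rs; lra.
  have [ts|st|->] := ltgtP t s; last by [].
    by have := H _ _ _ Ir It Is rt ts; lra.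
  by have := H _ _ _ Ir Is It rs st; lra.
have [[r Ir]|no1] := pselect (exists r, I r).
  exists 0, (h r) => t It; rewrite mul0r add0r.
  have [tr|rt|-> //] := ltgtP t r; exfalso; apply: no.
  - by exists t, r.
  - by exists r, t.
by exists 0, 0 => t It; exfalso; apply: no1; exists t.
Qed.

Lemma strictly_convex_separates (R : realType) (T : Type) (d : T -> T -> R)
  (V : normedModType R) (phi : T -> V) : @strictly_convex_norm R V ->
  (forall x y, `|phi x - phi y| = d x y) -> (forall x y, d x y = 0 -> x = y) ->
  separates_points d.
Proof.
move=> Vs phid d0 x y xy.
have [|f [flin fxy]] := @linear_functional_separates R V (phi x - phi y).
  by move=> /eqP; rewrite -normr_eq0 phid => /eqP/d0.
(* This is the form in which [f] passes through the chord identity. *)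
have fZ a v w : f (a *: (v - w)) = a * (f v - f w).
  have f0 : f 0 = 0.
    have := flin 1 0 0; rewrite scale1r addr0 mul1r => /eqP.
    by rewrite addrC -subr_eq subrr => /eqP <-.
  by rewrite -[X in f X]addr0 flin f0 addr0 addrC -scaleN1r flin; ring.
exists (f \o phi); split => [I gamma [_ gI]|/= fE]; last first.
  by apply: fxy; have := fZ 1 (phi x) (phi y); rewrite scale1r fE subrr mulr0.
apply: affine_of_chords => r s t Ir Is It rs st /=.
rewrite -!fZ; congr f.
by apply: (@geodesic_in_strictly_convex R V Vs I (phi \o gamma)) => // s' t' Is' It' /=;
  rewrite phid gI.
Qed.

(** * Broken geodesics and the embedding by affine functions *)

(** For points on different sides of [b], the triangle inequality through [b] bounds their distance
    above by [t - s]; the path from [a] to [c] through both bounds it below. *)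
Lemma geodesic_concat (R : realType) (T : Type) (d : T -> T -> R) (a b c : T) :
  is_metric d -> geodesic_space d -> d a c = d a b + d b c ->
  exists gamma, [/\ geodesic_on d `[0, d a c] gamma,
    gamma 0 = a, gamma (d a b) = b & gamma (d a c) = c].
Proof.
move=> dm geo abc.
have [g1 [[_ g1I] [g10 g11]]] := geo a b.
have [g2 [[_ g2I] [g20 g21]]] := geo b c.
have ab0 := dist_ge0 R T d dm a b; have bc0 := dist_ge0 R T d dm b c.
pose g t := if t <= d a b then g1 t else g2 (t - d a b).
have ga : g 0 = a by rewrite /g ab0.
have gb : g (d a b) = b by rewrite /g lexx.
have gc : g (d a c) = c.
  (* The first branch is taken at the end time only if [d b c = 0], and then [b = c]. *)
  rewrite /g abc; case: leP => [h|_]; last by rewrite addrC addKr.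
  have bc00 : d b c = 0 by lra.
  by rewrite bc00 addr0 g11; apply/(dm.1 b c).
exists g; split => //; split.
  move=> r s t /=; rewrite !in_itv /= => /andP[r0 _] /andP[_ tc] rs st.
  by rewrite (le_trans r0 rs) (le_trans st tc).
suff key s t : 0 <= s -> s <= t -> t <= d a c -> d (g s) (g t) = `|s - t|.
  move=> s t /=; rewrite !in_itv /= => /andP[s0 sc] /andP[t0 tc].
  have [st|/ltW ts] := leP s t; first exact: key.
  by rewrite (dist_sym R T d dm) distrC; exact: key.
move=> s0 st tc.
have I1 x : 0 <= x -> x <= d a b -> `[0, d a b]%classic x.
  by move=> ? ?; rewrite /= in_itv /=; apply/andP.
have I2 x : 0 <= x -> x <= d b c -> `[0, d b c]%classic x.
  by move=> ? ?; rewrite /= in_itv /=; apply/andP.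
rewrite /g; case: (leP t (d a b)) => tb; case: (leP s (d a b)) => sb.
- by apply: g1I; apply: I1 => //; lra.
- lra.
- have e1 : d a (g1 s) = s.
    by rewrite -g10 g1I; [rewrite sub0r normrN ger0_norm|apply: I1; lra..].
  have e2 : d (g1 s) b = d a b - s.
    by rewrite -{1}g11 g1I; [rewrite distrC ger0_norm; lra|apply: I1; lra..].
  have e3 : d b (g2 (t - d a b)) = t - d a b.
    by rewrite -{1}g20 g2I; [rewrite sub0r normrN ger0_norm; lra|apply: I2; lra..].
  have e4 : d (g2 (t - d a b)) c = d a c - t.
    by rewrite -{1}g21 g2I; [rewrite distrC ger0_norm; lra|apply: I2; lra..].
  have := dist_triangle R T d dm (g1 s) b (g2 (t - d a b)).
  have := dist_triangle R T d dm a (g1 s) c.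
  have := dist_triangle R T d dm (g1 s) (g2 (t - d a b)) c.
  rewrite e1 e2 e3 e4 distrC ger0_norm; lra.
- rewrite g2I; [|apply: I2; lra..].
  by congr `|_|; ring.
Qed.

Lemma separating_affine_embedding (R : realType) (T : Type) (d : T -> T -> R) (x0 : T) :
  is_metric d -> geodesic_space d -> separates_points d ->
  exists (V : normedModType R) (C : set V),
    @strictly_convex_norm R V /\ @convex_subset R V C /\ @isometric_to R T d V C.
Proof.
move=> dm geo sep.
pose I := {f : T -> R | affine_fun d f}.
pose phi (x : T) (i : I) := sval i x.
have [gam gamP] := choice (fun xy : T * T => geo xy.1 xy.2).
(* A chosen geodesic, rescaled to the unit interval. *)
pose conv t x y := gam (x, y) (t * d x y).
have inI t x y : 0 <= t <= 1 -> `[0, d x y]%classic (t * d x y).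
  move=> /andP[t0 t1]; have d0 := dist_ge0 R T d dm x y.
  by rewrite /= in_itv /= mulr_ge0 // ler_piMl.
apply: (@embedding_of_affine_coordinates R T d I phi conv dm _ _ _ x0).
- move=> x y xy; apply: contrapT => /sep[f [fa fxy]].
  exact/fxy/(xy (exist _ f fa)).
- move=> t x y [f fa] t01; rewrite /phi /conv /=.
  have [gg [g0 g1]] := gamP (x, y); have [k [m fE]] := fa _ _ gg.
  have e0 := fE _ (inI 0 x y ltac:(lra)); have e1 := fE _ (inI 1 x y ltac:(lra)).
  rewrite mul0r /= in e0; rewrite mul1r /= in e1; rewrite /= in g0 g1.
  rewrite g0 in e0; rewrite g1 in e1.
  by rewrite (fE _ (inI t x y t01)) e0 e1; ring.
- move=> s t x y s01 t01; rewrite /conv.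
  have [[_ gI] _] := gamP (x, y).
  rewrite gI; [|exact: inI..].
  by rewrite (_ : _ - _ = (s - t) * d x y) ?normrM ?(ger0_norm (dist_ge0 R T d dm x y)) //; ring.
- move=> a b c abc.
  have [g [gg ga gb gc]] := geodesic_concat R T d a b c dm geo abc.
  have ab0 := dist_ge0 R T d dm a b; have bc0 := dist_ge0 R T d dm b c.
  have {}inI t : 0 <= t <= d a c -> `[0, d a c]%classic t by rewrite /= in_itv /=.
  (* Every affine function has a single slope along the path through [b]; these slopes form [k]. *)
  have ex (i : I) : exists k : R, phi b i - phi a i = k * d a b /\
      phi c i - phi b i = k * d b c.
    case: i => f fa; rewrite /phi /=; have [k [m fE]] := fa _ _ gg; exists k.
    have e0 := fE 0 (inI 0 ltac:(lra)).
    have e1 := fE _ (inI (d a b) ltac:(lra)).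
    have e2 := fE _ (inI (d a c) ltac:(lra)).
    rewrite ga in e0; rewrite gb in e1; rewrite gc abc in e2.
    by rewrite e0 e1 e2; split; ring.
  have [k kE] := choice ex; by exists k.
Qed.

Theorem theorem1p1 (R : realType) (T : Type) (d : T -> T -> R)
  (hmet : is_metric d) (hgeo : geodesic_space d) :
  separates_points d <->
  exists (V : normedModType R) (C : set V),
    strictly_convex_norm V /\ convex_subset C /\ isometric_to d C.
Proof.
split=> [sep|[V [C [Vs [_ [phi [_ phid]]]]]]]; last first.
  apply: (strictly_convex_separates R T d V phi Vs phid) => x y.
  exact: (hmet.1 x y).1.
have [[x0 _]|T0] := pselect (exists x0 : T, True).
  exact: separating_affine_embedding.
(* An empty space has no base point and is embedded as the empty set. Any two numbers are dependent,
   so strict convexity of [R^o] holds vacuously. *)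
exists (R^o : normedModType R), set0; split; [|split].
- move=> v w vw.
  have [w0 /eqP] := vw w (- v) ltac:(by rewrite /GRing.scale /= mulrC mulNr subrr).
  rewrite oppr_eq0 => /eqP v0.
  have [|/eqP] := vw 1 0; last by rewrite oner_eq0.
  by rewrite v0 scale0r scaler0 addr0.
- by [].
- exists (fun=> 0); split=> [|x]; last by exfalso; apply: T0; exists x.
  by apply/seteqP; split => // y [x]; case: T0; exists x.
Qed.
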